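(* Let $\mathcal{C}$ be a combinatorial affine plane on a finite set $E$. Then $\mathrm{I}(\mathcal{C})$ is an integral simplex and $\mathcal{C}$ is non-separable. Consequently $\mathcal{C}$ is a precore clutter.
   Context: A clutter on a finite set $E$ is a family $\mathcal{C}\subseteq 2^E$ with no member containing another (members: hyperedges). A transversal is an inclusion-minimal subset of $E$ meeting every hyperedge; $\mathrm{b}(\mathcal{C})$ is the set of transversals, $\mathrm{bn}(\mathcal{C})$ the minimum size of a transversal, $\mathrm{minb}(\mathcal{C})$ the set of minimum-size transversals. A maximum fractional packing is a $y:\mathcal{C}\to\mathbb{R}_{\ge0}$ maximizing $\sum_H y(H)$ subject to $\sum_{H\ni a}y(H)\le1$ for all $a\in E$; $\mathrm{fpn}(\mathcal{C})$ is that maximum. $\mathcal{C}$ satisfies the integral blocking condition if $\mathrm{fpn}(\mathcal{C})=\mathrm{bn}(\mathcal{C})$. $\tilde{\mathcal{C}}=\{H\in\mathcal{C}: |H\cap B|=1\ \forall B\in\mathrm{minb}(\mathcal{C})\}$. Define $\mathrm{I}(\mathcal{C})=\{x\in\mathbb{R}^E: \langle x,1_D\rangle=1\ \forall D\in\mathrm{minb}(\mathcal{C}),\ \langle x,1_D\rangle\ge1\ \forall D\in\mathrm{b}(\mathcal{C}),\ x\ge0\}$. An integral simplex is a simplex whose vertices are integral. For $F\subseteq E$, $\mathcal{C}[F]=\{X\in\mathcal{C}: X\subseteq F\}$. $\mathcal{C}$ is separable if there is a partition $\{E_1,E_2\}$ of $E$ into two nonempty sets with $\mathrm{bn}(\mathcal{C})=\mathrm{bn}(\mathcal{C}[E_1])+\mathrm{bn}(\mathcal{C}[E_2])$,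 and non-separable otherwise. A precore clutter is a clutter $\mathcal{C}$ with $\mathcal{C}=\tilde{\mathcal{C}}$ that satisfies the integral blocking condition, has $\mathrm{I}(\mathcal{C})$ an integral polytope, and is non-separable. A combinatorial affine plane is a clutter such that (1) any two distinct hyperedges meet in exactly one element; (2) for every element $a$ and hyperedge $H\not\ni a$ there is a unique $b\in H$ with no hyperedge containing both $a,b$; (3) some three hyperedges have no common element. *)

(* Defs.v *)
From mathcomp Require Import classical_sets reals.
(* all_boot comes second so that set0 and setT denote finite sets. *)
From mathcomp Require Import all_boot all_order all_algebra.

Set Implicit Arguments.
Unset Strict Implicit.
Unset Printing Implicit Defensive.

Import Order.TTheory GRing.Theory Num.Theory.
Local Open Scope ring_scope.

Section Clutters.
Variable E : finType.
Implicit Types (C : {set {set E}}) (B F H : {set E}).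

Definition clutter C : Prop :=
  forall H K, H \in C -> K \in C -> H \subset K -> H = K.

Definition blocks C B : bool := [forall H in C, B :&: H != set0].

Definition transversals C : {set {set E}} :=
  [set B | minset (blocks C) B].

(* The default value #|E| is an upper bound for the size of any transversal,
   so it never affects the minimum; it is returned only if there is no
   transversal at all, i.e. if set0 \in C. *)
Definition bn C : nat := \big[minn/#|E|]_(B in transversals C) #|B|.

Definition minb C : {set {set E}} := [set B in transversals C | #|B| == bn C].

Definition tilde C : {set {set E}} :=
  [set H in C | [forall B in minb C, #|H :&: B| == 1%N]].

(* The ground set of the restriction is still E rather than F; transversals are
   minimal, hence contained in F, so bn is the same for both ground sets. *)
Definition restrict C F : {set {set E}} := [set H in C | H \subset F].

Definition separable C : Prop :=
  exists E1 E2 : {set E},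
    [/\ E1 != set0, E2 != set0, [disjoint E1 & E2], E1 :|: E2 = setT
      & bn C = (bn (restrict C E1) + bn (restrict C E2))%N].

Definition combinatorial_affine_plane C : Prop :=
  [/\ clutter C,
      forall H K, H \in C -> K \in C -> H != K -> #|H :&: K| = 1%N,
      forall a H, H \in C -> a \notin H ->
        exists! b, b \in H /\ ~ (exists K, [/\ K \in C, a \in K & b \in K])
    & exists H1 H2 H3,
        [/\ [/\ H1 \in C, H2 \in C & H3 \in C],
            [/\ H1 != H2, H1 != H3 & H2 != H3]
          & H1 :&: H2 :&: H3 = set0]].

End Clutters.

Section Polytopes.
Variables (R : realType) (E : finType).
(* R^o is R as a module over itself, which makes RE an R-vector space. *)
Local Notation RE := {ffun E -> R^o}.
Implicit Types (P : set RE) (x : RE).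

Definition indicator (D : {set E}) : RE := [ffun a => (a \in D)%:R].

Definition dot x (y : RE) : R := \sum_a (x a : R) * (y a : R).

Definition conv_hull n (v : 'I_n -> RE) : set RE := fun x =>
  exists c : 'I_n -> R,
    [/\ forall i, 0 <= c i, \sum_i c i = 1 & x = \sum_i c i *: v i].

Definition affinely_independent n (v : 'I_n -> RE) : Prop :=
  forall c : 'I_n -> R,
    \sum_i c i = 0 -> \sum_i c i *: v i = 0 -> forall i, c i = 0.

Definition polytope P : Prop :=
  exists (n : nat) (v : 'I_n -> RE), P = conv_hull v.

Definition simplex P : Prop :=
  exists (n : nat) (v : 'I_n.+1 -> RE),
    affinely_independent v /\ P = conv_hull v.

Definition vertex P x : Prop :=
  P x /\ forall (y z : RE) (t : R), P y -> P z -> 0 < t < 1 ->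
    x = t *: y + (1 - t) *: z -> y = x /\ z = x.

Definition integral_vertices P : Prop :=
  forall x, vertex P x -> forall a, (x a : R) \is a Num.int.

Definition integral_polytope P : Prop := polytope P /\ integral_vertices P.

Definition integral_simplex P : Prop := simplex P /\ integral_vertices P.

End Polytopes.

Section Precore.
Variables (R : realType) (E : finType).
Implicit Types (C : {set {set E}}) (y : {set E} -> R).

(* Only the values of y on the members of C matter. *)
Definition fractional_packing C y : Prop :=
  (forall H, H \in C -> 0 <= y H) /\
  (forall a : E, \sum_(H in C | a \in H) y H <= 1).

Definition packing_value C y : R := \sum_(H in C) y H.

Definition max_fractional_packing C y : Prop :=
  fractional_packing C y /\
  forall z, fractional_packing C z -> packing_value C z <= packing_value C y.

(* Relational, so that no value has to be chosen when the maximum does not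
   exist (which happens if set0 \in C). *)
Definition is_fpn C (r : R) : Prop :=
  exists2 y, max_fractional_packing C y & packing_value C y = r.

Definition integral_blocking C : Prop := is_fpn C (bn C)%:R.

Definition Ipoly C : set {ffun E -> R^o} := fun x =>
  [/\ forall D, D \in minb C -> dot x (indicator R D) = 1,
      forall D, D \in transversals C -> 1 <= dot x (indicator R D)
    & forall a, 0 <= (x a : R)].

Definition precore C : Prop :=
  [/\ clutter C, C = tilde C, integral_blocking C,
      integral_polytope (Ipoly C) & ~ separable C].

End Precore.

(* Main.v *)
(* View hyperedges as the points and elements as the lines of an affine plane of
   order n >= 2: there are n^2 points, n + 1 lines through each point, n points
   on each line, and every parallel class partitions the points into n lines. A
   cover by lines has at least n lines, with equality iff it covers each point
   exactly once, and the packing with all weights 1/n has value n.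
   Parallel classes are minimum transversals, so each x in I(C) has sum 1 on
   every class and total sum n + 1. A double count then shows that x is the
   affine combination of the indicators 1_K with the coefficients
   (<x, 1_K> - 1)/n, and these are nonnegative because the pencil K is itself a
   transversal. The Gram matrix nI + J of the 1_K is nonsingular on vectors with
   sum 0, whence affine independence. *)
Require Import Defs.
From mathcomp Require Import classical_sets reals.
From mathcomp Require Import all_boot all_order all_algebra.

Set Implicit Arguments.
Unset Strict Implicit.
Unset Printing Implicit Defensive.

Import Order.TTheory GRing.Theory Num.Theory.
Local Open Scope ring_scope.

(** * Blocking sets, the blocking number and weak duality *)

Section Blocking.
Variable E : finType.
Implicit Types (C : {set {set E}}) (B : {set E}).

Lemma bn_le_card C B : blocks C B -> (bn C <= #|B|)%N.
Proof.
move=> /minset_exists[A minA AB]; apply: leq_trans (subset_leq_card AB).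
have tA : A \in transversals C by rewrite inE.
(* [minn] has no neutral element on [nat], so the bound by one member is proved by induction along
   the enumeration. *)
rewrite /bn; elim: index_enum (mem_index_enum A) => //= D s IHs.
rewrite inE big_cons => /orP[/eqP <-|/IHs sA]; first by rewrite tA geq_minl.
by case: ifP => // _; apply: leq_trans sA; apply: geq_minr.
Qed.

(** The premise [m <= #|E|] covers the default value of the minimum defining [bn]. *)
Lemma leq_bn C m : (m <= #|E|)%N ->
  (forall B, blocks C B -> (m <= #|B|)%N) -> (m <= bn C)%N.
Proof.
move=> mE mB; rewrite /bn; elim/big_ind: _ => // [x y mx my|B].
  by rewrite leq_min mx.
by rewrite inE => /minsetp/mB.
Qed.

Lemma bn_set0 : bn (set0 : {set {set E}}) = 0%N.
Proof.
apply/eqP; rewrite -leqn0 -(cards0 E); apply: bn_le_card.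
by apply/forall_inP => H; rewrite inE.
Qed.

Lemma minb_transversal C B : B \in transversals C -> #|B| = bn C -> B \in minb C.
Proof. by move=> tB cB; apply/setIdP; split=> //; apply/eqP. Qed.

(** Weak duality: adding up the loads of the elements of [B] counts each hyperedge's weight at least
    once, and every load is at most 1. *)
Lemma packing_value_le (R : realType) C (y : {set E} -> R) B :
  fractional_packing C y -> blocks C B -> packing_value C y <= #|B|%:R.
Proof.
move=> [y0 y1] /forall_inP bB.
apply: (@le_trans _ _ (\sum_(a in B) \sum_(H in C | a \in H) y H)); last first.
  by rewrite -sumr_const; apply: ler_sum => a _; exact: y1.
rewrite (exchange_big_dep (mem C)) /=; last by move=> a H _ /andP[].
apply: ler_sum => H HC; have /set0Pn[a /setIP[aB aH]] := bB H HC.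
rewrite (bigD1 a) /= ?HC ?aB ?aH // lerDl.
by apply: sumr_ge0 => b /andP[/andP[_ _] _]; apply: y0.
Qed.

End Blocking.

(** * Pairings with indicators, and vertices of convex hulls *)

Section ConvexHull.
Variables (R : realType) (E : finType).
Local Notation RE := {ffun E -> R^o}.

Lemma dot_indicator (x : RE) (D : {set E}) :
  dot x (indicator R D) = \sum_(a in D) (x a : R).
Proof.
rewrite /dot [RHS]big_mkcond /=; apply: eq_bigr => a _.
by rewrite ffunE; case: ifP; rewrite ?mulr1 ?mulr0.
Qed.

Lemma dot_indicators (D F : {set E}) :
  dot (indicator R D) (indicator R F) = #|D :&: F|%:R.
Proof.
rewrite dot_indicator -sum1_card natr_sum [LHS]big_mkcond [RHS]big_mkcond /=.
by apply: eq_bigr => a _; rewrite inE ffunE andbC; case: (a \in F); case: (a \in D).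
Qed.

Lemma dot_sumZl n (c : 'I_n -> R) (v : 'I_n -> RE) (y : RE) :
  dot (\sum_i c i *: v i) y = \sum_i c i * dot (v i) y.
Proof.
rewrite /dot; under [RHS]eq_bigr do rewrite mulr_sumr.
rewrite exchange_big /=; apply: eq_bigr => a _.
by rewrite sum_ffunE mulr_suml; apply: eq_bigr => i _; rewrite ffunE mulrA.
Qed.

Lemma conv_hull_gen n (v : 'I_n -> RE) i : conv_hull v (v i).
Proof.
exists (fun j => (j == i)%:R); split=> [j||]; first exact: ler0n.
  by rewrite (bigD1 i) //= eqxx big1 ?addr0 // => j /negPf->.
by rewrite (bigD1 i) //= eqxx scale1r big1 ?addr0 // => j /negPf->; rewrite scale0r.
Qed.

(** Some weight [c i] is nonzero. If it is below 1, [x] lies strictly between [v i] and the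
    renormalised combination of the other generators, so extremality forces [x = v i]. *)
Lemma vertex_conv_hull n (v : 'I_n -> RE) (x : RE) :
  vertex (conv_hull v) x -> exists i, x = v i.
Proof.
move=> [[c [c0 c1 xE]] xmax].
have [i ci0] : exists i, c i != 0.
  apply/existsP; apply: contraT; rewrite negb_exists => /forallP ci.
  move: c1; rewrite big1 => [/eqP|i _]; first by rewrite eq_sym oner_eq0.
  by apply/eqP; move: (ci i); rewrite negbK.
exists i; have ci_gt0 : 0 < c i by rewrite lt_def ci0 c0.
have rest : \sum_(j | j != i) c j = 1 - c i by rewrite -c1 [in RHS](bigD1 i) //= [RHS]addrC addKr.
have [ci1|ci_neq1] := eqVneq (c i) 1.
  rewrite xE (bigD1 i) //= ci1 scale1r big1 ?addr0 // => j ji.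
  suff -> : c j = 0 by rewrite scale0r.
  have /eqP := rest; rewrite ci1 subrr psumr_eq0 //= => /allP/(_ j).
  by rewrite mem_index_enum ji /= => /(_ isT)/eqP.
have ci_lt1 : 0 < 1 - c i.
  rewrite lt_def subr_eq0 eq_sym ci_neq1 /= -rest.
  by apply: sumr_ge0.
pose d j := if j == i then 0 else c j / (1 - c i).
have zP : conv_hull v (\sum_j d j *: v j).
  exists d; split=> // [j|].
    by rewrite /d; case: ifP => // _; rewrite divr_ge0 // ltW.
  rewrite (bigD1 i) //= /d eqxx add0r -[RHS](divff (lt0r_neq0 ci_lt1)) -rest mulr_suml.
  by apply: eq_bigr => j /negPf->.
have [||//] := xmax _ _ (c i) (conv_hull_gen v i) zP.
  by rewrite ci_gt0 -subr_gt0.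
rewrite xE (bigD1 i) //=; congr (_ + _).
rewrite [in RHS](bigD1 i) //= {1}/d eqxx scale0r add0r scaler_sumr.
apply: eq_bigr => j /negPf ji; rewrite /d ji scalerA mulrCA divff ?mulr1 //.
exact: lt0r_neq0.
Qed.

Lemma conv_hull_Ipoly (C : {set {set E}}) n (v : 'I_n -> RE) (x : RE) :
  (forall i, Ipoly C (v i)) -> conv_hull v x -> Ipoly C x.
Proof.
move=> vI [c [c0 c1 ->]]; split=> [D DC|D DC|a].
- rewrite dot_sumZl -[RHS]c1; apply: eq_bigr => i _.
  by case: (vI i) => -> // _ _; rewrite mulr1.
- rewrite dot_sumZl -c1; apply: ler_sum => i _; case: (vI i) => _ vD _.
  by rewrite ler_peMr // vD.
- rewrite sum_ffunE; apply: sumr_ge0 => i _; rewrite ffunE.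
  by apply: mulr_ge0 => //; case: (vI i).
Qed.

End ConvexHull.

(** * Incidence in the dual plane: hyperedges are points, elements are lines *)

Section AffinePlane.
Variables (E : finType) (C : {set {set E}}).
Hypothesis planeC : combinatorial_affine_plane C.
Implicit Types (a b c : E) (H K : {set E}).

(** The disjunct [a == b] makes each line a member of its own parallel class. *)
Definition parallel a b : bool :=
  (a == b) || [forall K in C, ~~ ((a \in K) && (b \in K))].

Definition pclass a : {set E} := [set b | parallel a b].

(** In the dual reading this is the set of points on the line [a]; the pencil of lines through a
    point [H] is [H] itself. *)
Definition star a : {set {set E}} := [set H in C | a \in H].

Lemma parallel_sym a b : parallel a b = parallel b a.
Proof.
by rewrite /parallel eq_sym; congr (_ || _); apply: eq_forallb_in => K _; rewrite andbC.
Qed.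

Lemma mem_pclass a : a \in pclass a.
Proof. by rewrite inE /parallel eqxx. Qed.

Lemma card_meet H K : H \in C -> K \in C -> H != K -> #|H :&: K| = 1%N.
Proof. by case: planeC => _ + _ _; apply. Qed.

Lemma parallel_hyperedge H a b :
  H \in C -> a \in H -> b \in H -> parallel a b = (a == b).
Proof.
move=> HC aH bH; rewrite /parallel; case: eqP => //= _.
by apply/negP => /forall_inP/(_ H HC); rewrite aH bH.
Qed.

(** Playfair's axiom. Off [H] it is the parallel clause of the definition; if [a] passes through
    [H], then [a] is its own only parallel there. *)
Lemma card_pclass_meet H a : H \in C -> #|H :&: pclass a| = 1%N.
Proof.
move=> HC; apply/eqP/cards1P; have [aH|aNH] := boolP (a \in H).
  exists a; apply/setP => b; rewrite !inE; case: (boolP (b \in H)) => bH /=.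
    by rewrite (parallel_hyperedge HC) // eq_sym.
  by apply/esym/negP => /eqP ba; rewrite ba aH in bH.
case: planeC => _ _ /(_ a H HC aNH) [b [[bH bN] bU]] _.
exists b; apply/setP => d; rewrite !inE; apply/andP/eqP => [[dH]|->].
  rewrite /parallel => /orP[/eqP ad|/forall_inP nK]; first by rewrite ad dH in aNH.
  by apply/esym/bU; split=> // -[K [KC aK dK]]; have := nK K KC; rewrite aK dK.
split=> //; rewrite /parallel; apply/orP; right; apply/forall_inP => K KC.
by apply/negP => /andP[aK bK]; apply: bN; exists K.
Qed.

(** Two common points of [a] and [b] would be joined by two lines, but distinct hyperedges share
    only one element. *)
Lemma card_two_lines a b : a != b ->
  #|[set H in C | (a \in H) && (b \in H)]| = ~~ parallel a b :> nat.
Proof.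
move=> ab; rewrite /parallel (negPf ab) /=.
have [/forall_inP noK|] /= :=
  boolP [forall K in C, ~~ ((a \in K) && (b \in K))].
  apply/eqP; rewrite cards_eq0 -subset0; apply/subsetP => K.
  by rewrite !inE => /andP[/noK/negPf->].
rewrite negb_forall_in => /exists_inP[K KC]; rewrite negbK => abK /=.
apply/eqP/cards1P; exists K; apply/setP => H; rewrite !inE.
apply/andP/eqP => [[HC abH]|->//]; apply/eqP; apply: contraT => HK.
have /eqP/cards1P[d HKd] := card_meet HC KC HK.
case/andP: abK => aK bK; case/andP: abH => aH bH.
have : a \in H :&: K by rewrite inE aH.
have : b \in H :&: K by rewrite inE bH.
by rewrite HKd !inE => /eqP bd /eqP ad; rewrite ad bd eqxx in ab.
Qed.

(** Exactly one line through [H] is parallel to [a]; the others correspond to the points of [a] by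
    joining these to [H]. *)
Lemma card_hyperedge_star H a : H \in C -> a \notin H -> #|H| = #|star a|.+1.
Proof.
move=> HC aNH.
have -> : #|star a| = (\sum_(b in H) ~~ parallel a b)%N.
  transitivity (\sum_(K in star a) #|H :&: K|)%N.
    rewrite -sum1_card; apply: eq_bigr => K; rewrite inE => /andP[KC aK].
    rewrite card_meet //; apply: contraNneq aNH => ->; exact: aK.
  under eq_bigr do rewrite -sum1_card big_mkcond /=.
  rewrite exchange_big /= [RHS]big_mkcond /=; apply: eq_bigr => b _.
  case: ifP => bH; last by rewrite big1 // => K _; rewrite inE bH.
  rewrite -card_two_lines; last by apply: contraNneq aNH => ->.
  rewrite -sum1_card -big_mkcondr /=; apply: eq_bigl => K.
  by rewrite /star !inE bH -andbA.
have pH : (\sum_(b in H) parallel a b)%N = 1%N.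
  rewrite -(card_pclass_meet a HC) -[RHS]sum1_card [LHS]big_mkcond [RHS]big_mkcond /=.
  by apply: eq_bigr => b _; rewrite !inE; case: (b \in H); case: (parallel a b).
rewrite -[RHS]addn1 -pH -big_split /= -sum1_card; apply: eq_bigr => b _.
by case: (parallel a b).
Qed.

Lemma exists_avoiding a : exists2 H, H \in C & a \notin H.
Proof.
case: planeC => _ _ _ [H1 [H2 [H3 [[C1 C2 C3] _ H0]]]].
have : a \notin H1 :&: H2 :&: H3 by rewrite H0 inE.
rewrite !inE !negb_and => /orP[/orP[]|] aN; by [exists H1|exists H2|exists H3].
Qed.

(** Let [c] join [H] and [K]. A parallel [b] of [c] through a point [L] off [c] avoids both, so each
    lies on one line more than [b] has points. *)
Lemma card_hyperedges_eq H K : H \in C -> K \in C -> #|H| = #|K|.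
Proof.
move=> HC KC; have [->//|HK] := eqVneq H K.
have /eqP/cards1P[c HKc] := card_meet HC KC HK.
have /setIP[cH cK] : c \in H :&: K by rewrite HKc inE.
have [L LC cL] := exists_avoiding c.
have /eqP/cards1P[b Lb] := card_pclass_meet c LC.
have /setIP[bL] : b \in L :&: pclass c by rewrite Lb inE.
rewrite inE => cb.
have bN M : M \in C -> c \in M -> b \notin M.
  move=> MC cM; apply/negP => bM; move: cb.
  by rewrite (parallel_hyperedge MC) // => /eqP cb; rewrite cb bL in cL.
by rewrite (card_hyperedge_star HC (bN H HC cH)) (card_hyperedge_star KC (bN K KC cK)).
Qed.

(** All lines have equally many points, and the line [c] joining [H1] and [H2] has at least these
    two. *)
Lemma card_star_gt1 a : (1 < #|star a|)%N.
Proof.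
have [H HC aH] := exists_avoiding a.
rewrite -ltnS -(card_hyperedge_star HC aH).
case: planeC => _ _ _ [H1 [H2 [H3 [[C1 C2 C3] [N12 N13 N23] H0]]]].
rewrite (card_hyperedges_eq HC C3).
have /eqP/cards1P[c Hc] := card_meet C1 C2 N12.
have /setIP[c1 c2] : c \in H1 :&: H2 by rewrite Hc inE.
have cN3 : c \notin H3.
  by apply/negP => c3; have := in_set0 c; rewrite -H0 !inE c1 c2 c3.
rewrite (card_hyperedge_star C3 cN3) ltnS.
apply: (@leq_trans #|[set H1; H2]|); first by rewrite cards2 N12.
by apply/subset_leq_card/subsetP => K; rewrite !inE => /orP[]/eqP->; apply/andP.
Qed.

Lemma affine_plane_order : exists n, [/\ (1 < n)%N,
  forall H, H \in C -> #|H| = n.+1 & forall a, #|star a| = n].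
Proof.
have [H [a HC]] : exists H a, H \in C.
  case: planeC => _ _ _ [H [K [_ [[HC KC _] [HK _ _] _]]]].
  have /eqP/cards1P[a _] := card_meet HC KC HK.
  by exists H, a.
have starE b : #|star b|.+1 = #|H|.
  have [K KC bK] := exists_avoiding b.
  by rewrite -(card_hyperedge_star KC bK) (card_hyperedges_eq KC HC).
exists #|star a|; split=> [|K KC|b]; first exact: card_star_gt1.
  by rewrite starE (card_hyperedges_eq KC HC).
by apply: succn_inj; rewrite !starE.
Qed.

End AffinePlane.

(** * Counting in a plane of order [n]: minimum transversals and non-separability *)

Section AffinePlaneOrder.
Variables (E : finType) (C : {set {set E}}) (n : nat).
Hypothesis planeC : combinatorial_affine_plane C.
Hypothesis n_gt1 : (1 < n)%N.
Hypothesis card_hyperedge : forall H, H \in C -> #|H| = n.+1.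
Hypothesis card_star : forall a, #|star C a| = n.
Implicit Types (a b : E) (B D H K : {set E}).

Let n_gt0 : (0 < n)%N. Proof. exact: ltnW. Qed.

Lemma sum_card_meet D : (\sum_(H in C) #|H :&: D| = #|D| * n)%N.
Proof.
under eq_bigr do rewrite -sum1_card big_mkcond /=.
rewrite exchange_big /= -sum_nat_const [RHS]big_mkcond /=; apply: eq_bigr => a _.
case: ifP => aD; last by rewrite big1 // => H _; rewrite inE aD andbF.
rewrite -(card_star a) -sum1_card -big_mkcondr /=; apply: eq_bigl => H.
by rewrite !inE aD andbT.
Qed.

(** Apply [sum_card_meet] to a pencil [H]: the term of [H] is [n.+1], all others are 1, and the
    total is [n.+1 * n]. *)
Lemma card_plane : #|C| = (n * n)%N.
Proof.
have [H HC] : exists H, H \in C by case: planeC => _ _ _ [H [? [? [[]]]]]; exists H.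
have := sum_card_meet H; rewrite (card_hyperedge HC) mulSn (bigD1 H) //= setIid.
rewrite (card_hyperedge HC) (cardsD1 H) HC addSn add1n => /eqP.
rewrite -addnS eqn_add2l => /eqP <-; congr _.+1.
rewrite -sum1_card; rewrite [RHS](eq_bigr (fun=> 1%N)) => [|K /andP[KC KH]].
  by apply: eq_bigl => K; rewrite !inE andbC.
by rewrite (card_meet planeC) // eq_sym.
Qed.

Lemma leq_card_blocks B : blocks C B -> (n <= #|B|)%N.
Proof.
move=> /forall_inP bB; rewrite -(leq_pmul2r n_gt0) -card_plane -sum_card_meet -sum1_card.
by apply: leq_sum => H HC; rewrite card_gt0 setIC bB.
Qed.

Lemma blocks_pclass a : blocks C (pclass C a).
Proof.
by apply/forall_inP => H HC; rewrite -card_gt0 setIC (card_pclass_meet planeC).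
Qed.

Lemma card_pclass a : #|pclass C a| = n.
Proof.
apply/eqP; rewrite -(eqn_pmul2r n_gt0) -card_plane -sum_card_meet -sum1_card.
by apply/eqP/eq_bigr => H HC; rewrite (card_pclass_meet planeC).
Qed.

Lemma plane_inhabited : exists H a, (H \in C) && (a \in H).
Proof.
case: planeC => _ _ _ [H [K [_ [[HC KC _] [HK _ _] _]]]].
have /eqP/cards1P[a HKa] := card_meet planeC HC KC HK.
exists H, a; rewrite HC /=; have : a \in H :&: K by rewrite HKa inE.
by case/setIP.
Qed.

Lemma bn_plane : bn C = n.
Proof.
have [_ [a _]] := plane_inhabited.
apply/eqP; rewrite eqn_leq -{1}(card_pclass a) bn_le_card ?blocks_pclass //=.
apply: leq_bn leq_card_blocks; rewrite -(card_pclass a); exact: max_card.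
Qed.

Lemma minb_blocks D : D \in minb C -> blocks C D.
Proof. by move=> /setIdP[]; rewrite inE => /minsetp. Qed.

Lemma card_minb D : D \in minb C -> #|D| = n.
Proof. by move=> /setIdP[_ /eqP]; rewrite bn_plane. Qed.

Lemma pclass_minb a : pclass C a \in minb C.
Proof.
apply: minb_transversal; last by rewrite card_pclass bn_plane.
rewrite inE; apply/minsetP; split=> [|B bB Ba]; first exact: blocks_pclass.
by apply/eqP; rewrite eqEcard Ba card_pclass leq_card_blocks.
Qed.

(** Equality case of the covering bound: [n * n] terms, each at least 1, sum to [n * n]. *)
Lemma card_minb_meet D H : D \in minb C -> H \in C -> #|H :&: D| = 1%N.
Proof.
move=> Dm HC; have /forall_inP bD := minb_blocks Dm.
have D_gt0 K : K \in C -> (1 <= #|K :&: D|)%N by move=> KC; rewrite card_gt0 setIC bD.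
have := leqif_sum (fun K KC => leqif_eq (D_gt0 K KC)).
rewrite sum1_card card_plane sum_card_meet (card_minb Dm) => -[_].
by rewrite eqxx => /esym/forall_inP/(_ H HC)/eqP.
Qed.

(** A line [a] of the pencil [H] cannot be dropped: since [n > 1] it carries another point [K], and
    [a] is the only line joining [K] to [H]. *)
Lemma hyperedge_transversal H : H \in C -> H \in transversals C.
Proof.
move=> HC; rewrite inE; apply/minsetP; split=> [|B /forall_inP bB BH].
  apply/forall_inP => K KC; have [<-|HK] := eqVneq H K.
    by rewrite setIid -card_gt0 (card_hyperedge HC).
  by rewrite -card_gt0 (card_meet planeC).
apply/eqP; rewrite eqEsubset BH; apply/subsetP => a aH.
have [K] : exists K, K \in star C a :\ H.
  apply/card_gt0P; have := card_star a; rewrite (cardsD1 H) !inE HC aH => nE.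
  by rewrite -ltnS -[X in (_ < X)%N]add1n nE.
rewrite !inE => /and3P[KH KC aK]; have /set0Pn[b /setIP[bB' bK]] := bB K KC.
have /eqP/cards1P[d KHd] := card_meet planeC KC HC KH.
have : a \in K :&: H by rewrite inE aK.
have : b \in K :&: H by rewrite inE bK (subsetP BH).
by rewrite KHd !inE => /eqP bd /eqP ->; rewrite -bd.
Qed.

(** Distinct lines either share one point or are parallel. Including the case [a = b] gives one
    formula for the coefficient of [x b] in [sum_dot_star]. *)
Lemma card_lines_through a b :
  (#|[set K in star C a | b \in K]| + parallel C a b = 1 + n * (a == b))%N.
Proof.
have [<-|ab] := eqVneq a b.
  rewrite /parallel eqxx muln1 addnC -(card_star a); congr (_ + _)%N.
  by apply: eq_card => K; rewrite !inE -andbA andbb.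
rewrite muln0.
have -> : [set K in star C a | b \in K] =
    [set K in C | (a \in K) && (b \in K)].
  by apply/setP => K; rewrite !inE andbA.
by rewrite (card_two_lines planeC ab); case: (parallel C a b).
Qed.

Lemma plane_not_separable : ~ separable C.
Proof.
move=> [E1 [E2 [E1n0 E2n0 dis cover]]].
(* All hyperedges meet, so one side contains no hyperedge; removing a line of
   that side from its parallel class blocks all hyperedges on the other side. *)
have one_side (F1 F2 : {set E}) : [disjoint F1 & F2] -> F1 :|: F2 = setT -> F2 != set0 ->
    restrict C F2 = set0 -> (bn (restrict C F1) < n)%N.
  move=> dF cF /set0Pn[a aF2] _.
  rewrite -(card_pclass a) (cardsD1 a) mem_pclass add1n ltnS; apply: bn_le_card.
  apply/forall_inP => H; rewrite inE => /andP[HC HF1].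
  have /forall_inP/(_ H HC)/set0Pn[b /setIP[bP bH]] := blocks_pclass a.
  apply/set0Pn; exists b; rewrite in_setI in_setD1 bH bP !andbT.
  apply: contraTneq (subsetP HF1 _ bH) => ->.
  by rewrite (disjointFl dF aF2).
have [r1|/set0Pn[H]] := eqVneq (restrict C E1) set0.
  rewrite r1 bn_set0 add0n bn_plane => nE.
  have := one_side E2 E1; rewrite disjoint_sym setUC -nE ltnn => lt_nn.
  by have := lt_nn dis cover E1n0 r1.
rewrite inE => /andP[HC HE1].
have r2 : restrict C E2 = set0.
  apply/setP => K; rewrite !inE; apply/negP => /andP[KC KE2].
  have /set0Pn[a /setIP[aH aK]] : H :&: K != set0.
    have [<-|HK] := eqVneq H K; first by rewrite setIid -card_gt0 (card_hyperedge HC).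
    by rewrite -card_gt0 (card_meet planeC).
  by have := disjointFr dis (subsetP HE1 a aH); rewrite (subsetP KE2 a aK).
rewrite r2 bn_set0 addn0 bn_plane => nE.
by have := one_side E1 E2 dis cover E2n0 r2; rewrite -nE ltnn.
Qed.

Lemma tilde_plane : C = tilde C.
Proof.
apply/setP => H; rewrite inE; case: (boolP (H \in C)) => //= HC.
by apply/esym/forall_inP => B Bm; rewrite card_minb_meet.
Qed.

(** * The optimal packing, and barycentric coordinates on [Ipoly C] *)

Section Real.
Variable R : realType.
Local Notation RE := {ffun E -> R^o}.
Implicit Types x : RE.

Lemma natr_n_neq0 : n%:R != 0 :> R.
Proof. by rewrite pnatr_eq0 -lt0n. Qed.

Lemma integral_blocking_plane : integral_blocking R C.
Proof.
rewrite /integral_blocking bn_plane; have [_ [a0 _]] := plane_inhabited.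
have sum_n : packing_value C (fun=> n%:R^-1) = n%:R :> R.
  by rewrite /packing_value sumr_const card_plane -[LHS]mulr_natl natrM mulfK // natr_n_neq0.
exists (fun=> n%:R^-1) => //; split; first split=> [H _|a].
- by rewrite invr_ge0 ler0n.
- have -> : \sum_(H in C | a \in H) (n%:R^-1 : R) = n%:R^-1 *+ #|star C a|.
    by rewrite -sumr_const; apply: eq_bigl => H; rewrite inE.
  by rewrite card_star -[leLHS]mulr_natl divff ?natr_n_neq0.
- move=> z zP; rewrite sum_n -(card_pclass a0).
  exact: packing_value_le zP (blocks_pclass a0).
Qed.

Lemma Ipoly_indicator H : H \in C -> Ipoly C (indicator R H).
Proof.
move=> HC; split=> [D Dm|D|a]; rewrite ?dot_indicators.
- by rewrite card_minb_meet.
- rewrite inE => /minsetp/forall_inP/(_ H HC).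
  by rewrite setIC -card_gt0 ler1n.
- by rewrite ffunE ler0n.
Qed.

(** Each line is parallel to exactly one line through the point [H], so it is summed once. *)
Lemma sum_parallel x H : H \in C ->
  \sum_(a in H) \sum_(b in pclass C a) (x b : R) = \sum_a (x a : R).
Proof.
move=> HC; rewrite (exchange_big_dep predT) //=; apply: eq_bigr => b _.
rewrite (eq_bigl [in H :&: pclass C b]).
  by rewrite sumr_const (card_pclass_meet planeC).
by move=> a; rewrite !inE parallel_sym.
Qed.

Lemma sum_Ipoly x : Ipoly C x -> \sum_a (x a : R) = n.+1%:R.
Proof.
move=> [xm _ _]; have [H [_ /andP[HC _]]] := plane_inhabited.
rewrite -(sum_parallel x HC) -(card_hyperedge HC) -sumr_const.
by apply: eq_bigr => a _; rewrite -dot_indicator xm ?pclass_minb.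
Qed.

Lemma sum_dot_star x a : Ipoly C x ->
  \sum_(K in star C a) dot x (indicator R K) = n%:R + n%:R * (x a : R).
Proof.
move=> xI; have [xm _ _] := xI.
(* The added class sum equals 1. It completes [n] to [n.+1], the total of [x], so both sides can be
   compared coefficient by coefficient. *)
apply: (addIr (\sum_(b in pclass C a) (x b : R))).
rewrite -{2}dot_indicator xm ?pclass_minb // addrAC natr1 -(sum_Ipoly xI).
under eq_bigr do rewrite dot_indicator.
rewrite (exchange_big_dep predT) //= [X in _ + X]big_mkcond -big_split /=.
have -> : n%:R * (x a : R) = \sum_b (x b : R) *+ (n * (a == b)).
  rewrite (bigD1 a) //= eqxx muln1 big1 ?addr0 ?mulr_natl // => b ba.
  by rewrite eq_sym (negPf ba) muln0.
rewrite -big_split /=; apply: eq_bigr => b _.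
rewrite -[X in _ = X + _]mulr1n -mulrnDr -card_lines_through mulrnDr; congr (_ + _).
  by rewrite -sumr_const; apply: eq_bigl => K; rewrite !inE.
by rewrite inE; case: (parallel C a b).
Qed.

(** Since [#|K :&: H|] is [n.+1] if [K = H] and 1 otherwise, this affine function is 1 at the
    indicator of [H] and 0 at those of the other hyperedges. *)
Definition bary x H : R := (dot x (indicator R H) - 1) / n%:R.

Lemma bary_ge0 x H : Ipoly C x -> H \in C -> 0 <= bary x H.
Proof.
move=> [_ xt _] HC; rewrite divr_ge0 ?ler0n // subr_ge0.
by rewrite xt ?hyperedge_transversal.
Qed.

Lemma baryE x : Ipoly C x -> x = \sum_(H in C) bary x H *: indicator R H.
Proof.
move=> xI; apply/ffunP => a; rewrite sum_ffunE.
transitivity (\sum_(H in star C a) bary x H).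
  rewrite -mulr_suml sumrB sum_dot_star // sumr_const card_star addrAC subrr add0r.
  by rewrite mulrAC divff ?mul1r ?natr_n_neq0.
rewrite [LHS]big_mkcond [RHS]big_mkcond /=; apply: eq_bigr => H _.
rewrite !inE; case: (H \in C) => //=; rewrite !ffunE.
by case: (a \in H); rewrite /GRing.scale /= ?mulr1 ?mulr0.
Qed.

(** Every line has [n] points, so the pairings add up to [n.+1 * n]; subtracting 1 for each of the
    [n * n] points leaves [n]. *)
Lemma sum_bary x : Ipoly C x -> \sum_(H in C) bary x H = 1.
Proof.
move=> xI; have -> : \sum_(H in C) bary x H =
    (\sum_(H in C) dot x (indicator R H) - (n * n)%:R) / n%:R.
  by rewrite -mulr_suml sumrB sumr_const card_plane.
have -> : \sum_(H in C) dot x (indicator R H) = n.+1%:R * n%:R.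
  under eq_bigr do rewrite dot_indicator.
  rewrite (exchange_big_dep predT) //= -(sum_Ipoly xI) mulr_suml.
  apply: eq_bigr => a _; rewrite mulr_natr -[in RHS](card_star a) -sumr_const.
  by apply: eq_bigl => H; rewrite inE.
by rewrite -natrM -natrB ?leq_mul // -mulnBl subSnn mul1n divff ?natr_n_neq0.
Qed.

Lemma affinely_independent_indicators m (e : 'I_m -> {set E}) :
  injective e -> (forall i, e i \in C) ->
  affinely_independent (fun i => indicator R (e i)).
Proof.
move=> e_inj eC c c0 cv j; apply: (mulIf natr_n_neq0); rewrite mul0r.
transitivity (dot (\sum_i c i *: indicator R (e i)) (indicator R (e j))); last first.
  by rewrite cv /dot big1 // => a _; rewrite ffunE mul0r.
(* The zero sum of the [c i] is added on the left: the Gram entries are [n.+1] on the diagonal and 1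
   elsewhere, so the pairing is that sum plus [c j * n]. *)
rewrite dot_sumZl -[LHS]add0r -[X in X + _ = _]c0 (bigD1 j) //= [in RHS](bigD1 j) //= addrAC.
rewrite dot_indicators setIid card_hyperedge // -natr1 mulrDr mulr1.
rewrite [c j + _]addrC; congr (_ + _).
apply: eq_bigr => i ij; rewrite dot_indicators (card_meet planeC) ?mulr1 //.
by rewrite (inj_eq e_inj).
Qed.

Lemma integral_simplex_plane : integral_simplex (@Ipoly R E C).
Proof.
(* A simplex is indexed by a successor ordinal, so [C] must be seen to be nonempty. *)
have [k Ck] : exists k, #|C| = k.+1.
  by exists #|C|.-1; rewrite prednK // card_plane muln_gt0 n_gt0.
pose e (i : 'I_k.+1) := nth finset.set0 (enum C) i.
have eC i : e i \in C by rewrite -mem_enum mem_nth // -cardE Ck.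
have e_inj : injective e.
  move=> i j /eqP; rewrite nth_uniq ?enum_uniq -?cardE ?Ck // => /eqP; exact: val_inj.
have big_e (V : nmodType) (F : {set E} -> V) : \sum_i F (e i) = \sum_(H in C) F H.
  by rewrite -[RHS]big_enum (big_nth finset.set0) -cardE Ck big_mkord.
have IE : @Ipoly R E C = conv_hull (fun i => indicator R (e i)).
  apply/classical_sets.seteqP; split=> x /= xI.
    exists (fun i => bary x (e i)); split=> [i||]; first exact: bary_ge0.
      by rewrite big_e sum_bary.
    by rewrite (big_e _ (fun H => bary x H *: indicator R H)) -baryE.
  by apply: conv_hull_Ipoly xI => i; apply: Ipoly_indicator.
split; first by exists k, (fun i => indicator R (e i)); split=> //;
  exact: affinely_independent_indicators.
move=> x; rewrite IE => /vertex_conv_hull[i ->] a.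
by rewrite ffunE; apply: rpred_nat.
Qed.

End Real.

End AffinePlaneOrder.

Theorem theorem5p9 (R : realType) (E : finType) (C : {set {set E}}) :
  combinatorial_affine_plane C ->
  [/\ integral_simplex (@Ipoly R E C), ~ separable C & precore R C].
Proof.
move=> planeC; have [n [n_gt1 cardH cards]] := affine_plane_order planeC.
have simplexC := integral_simplex_plane planeC n_gt1 cardH cards R.
have nsepC := plane_not_separable planeC n_gt1 cardH cards.
split=> //; split=> //; first by case: planeC.
- exact: tilde_plane planeC n_gt1 cardH cards.
- exact: integral_blocking_plane planeC n_gt1 cardH cards R.
- by case: simplexC => -[k [v [_ PE]]] intv; split=> //; exists k.+1, v.
Qed.
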